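(* Let $|q|<1$ and define integers $s_n,t_n$ by $$\sum_{n=0}^{\infty}s_nq^n=(q,q^4;q^5)_\infty^3(-q^3,-q^7;q^{10})_\infty,\qquad \sum_{n=0}^{\infty}t_nq^n=(q^2,q^3;q^5)_\infty^3(-q,-q^9;q^{10})_\infty.$$ Then $s_{5n+3}=0$ and $t_{5n+4}=0$ for all $n\ge0$.
   Context: For complex $a$ and $|q|<1$, $(a;q)_\infty=\prod_{k=0}^{\infty}(1-aq^k)$ and $(a_1,\dots,a_m;q)_\infty=(a_1;q)_\infty\cdots(a_m;q)_\infty$. *)

(* Defs.v *)
From HB Require Import structures.
From mathcomp Require Import all_boot all_order all_algebra.
From mathcomp Require Import complex.
From mathcomp Require Import all_classical all_reals all_analysis.

Set Implicit Arguments.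
Unset Strict Implicit.
Unset Printing Implicit Defensive.

Import Order.TTheory GRing.Theory Num.Theory.
Import numFieldNormedType.Exports.

Local Open Scope classical_set_scope.
Local Open Scope ring_scope.

(* The complex numbers over [R].  The topology of a [numFieldType] is canonical
   on the [sort] projections and not on the head symbol [complex], hence the
   named structure. *)
Definition Cplx (R : realType) : numClosedFieldType := R[i].

(* Meaningful for |q| < 1, where the partial products converge; the value of
   [lim] is unspecified when they diverge. *)
Definition qpoch_inf (C : numClosedFieldType) (a q : C) : C :=
  lim ((\prod_(0 <= k < n) (1 - a * q ^+ k)) @[n --> \oo]).

Definition qpochs_inf (C : numClosedFieldType) (a : seq C) (q : C) : C :=
  \prod_(x <- a) qpoch_inf x q.

(* The identity of functions on the open unit disc which determines the
   coefficients [c]. *)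
Definition power_series_expansion (C : numClosedFieldType) (c : nat -> int)
    (f : C -> C) : Prop :=
  forall q : C, `|q| < 1 ->
    series (fun n => (c n)%:~R * q ^+ n) @ \oo --> f q.

(* Main.v *)
Require Import Defs.
From HB Require Import structures.
From mathcomp Require Import all_boot all_order all_algebra.
From mathcomp Require Import complex.
From mathcomp Require Import all_classical all_reals all_analysis.
From mathcomp Require Import zify ring lra.

Set Implicit Arguments.
Unset Strict Implicit.
Unset Printing Implicit Defensive.

Import Order.TTheory GRing.Theory Num.Theory.
Import numFieldNormedType.Exports.

Local Open Scope classical_set_scope.
Local Open Scope ring_scope.

(** Multiplying the product by the series [(q^5;q^5)^3 (q^10;q^10)] in [q^5]
    does not affect the vanishing of its coefficients along a residue class
    modulo 5, and by the Jacobi triple product it gives a quadruple theta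
    series: for [s] the sum of [(-1)^(a+b+c) q^E] over integers [a, b, c, d],
    with [2 E = 5 (a^2 + b^2 + c^2) + 3 (a + b + c) + 10 d^2 + 4 d].  When
    [E = 3] modulo 5, [5 k = 2 (a + b + c - 2 d) + 1] has an odd solution [k],
    and [(a, b, c, d) |-> (a - k, b - k, c - k, d + k)] is an involution that
    preserves [E] and reverses the sign, so these terms cancel.  The case of
    [t] is the same with
    [2 E = 5 (a^2 + b^2 + c^2) + (a + b + c) + 10 d^2 + 8 d], [E = 4] modulo 5
    and [5 k = 2 (a + b + c - 2 d) - 1].

    The coefficients of the analytic expansion agree up to order [n] with those
    of the finite products of [n] factors, since both differ from the function
    by [O(x^n)] at small real [x > 0]; the triple product is thus only needed
    modulo [q^n], where it follows from its finite form with Gaussian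
    binomials. *)

(** * The finite Jacobi triple product *)

Section GaussBinomial.
Variables (D : idomainType) (p : D).

Fixpoint gauss_binom (N i : nat) : D :=
  match N, i with
  | _, 0 => 1
  | 0, _.+1 => 0
  | N'.+1, i'.+1 => gauss_binom N' i'.+1 + p ^+ (N' - i') * gauss_binom N' i'
  end.

(** This is [(p; p)_n]. *)
Definition qfact (n : nat) : D := \prod_(k < n) (1 - p ^+ k.+1).

Lemma qfact0 : qfact 0 = 1.
Proof. exact: big_ord0. Qed.

Lemma qfactS n : qfact n.+1 = qfact n * (1 - p ^+ n.+1).
Proof. by rewrite /qfact big_ord_recr. Qed.

Lemma gauss_binom0 N : gauss_binom N 0 = 1.
Proof. by case: N. Qed.

Lemma gauss_binom_small N i : (N < i)%N -> gauss_binom N i = 0.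
Proof.
elim: N i => [|N IH] [|i] //= lt_Ni.
by rewrite !IH ?mulr0 ?addr0 //; lia.
Qed.

(** The quotient formula, cleared of denominators. The induction splits the last factor as [1 -
    p^(i+m+2) = (1 - p^(m+1)) + p^(m+1) (1 - p^(i+1))]. *)
Lemma gauss_binom_qfact i m :
  gauss_binom (i + m) i * (qfact i * qfact m) = qfact (i + m).
Proof.
have [N] : exists N, N = (i + m)%N by exists (i + m)%N.
elim: N i m => [|N IH] [|i] m //= eN.
- have -> : m = 0%N by lia.
  by rewrite /= qfact0 !mulr1.
- by rewrite add0n gauss_binom0 qfact0 !mul1r.
have Nim : N = (i + m)%N by lia.
rewrite addSn /= !qfactS addKn.
have hi := IH i m Nim.
case: m => [|m] in eN Nim hi *.
  rewrite addn0 in hi *.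
  by rewrite gauss_binom_small // qfact0 add0r mul1r mulr1 -[in RHS]hi qfact0; ring.
have := IH i.+1 m ltac:(lia).
rewrite addSnnS.
move: hi; set Q := qfact (i + m.+1); rewrite -addSn exprD !qfactS => hi hi'.
transitivity ((1 - p ^+ m.+1) * Q + p ^+ m.+1 * (1 - p ^+ i.+1) * Q); last by ring.
by rewrite -{1}hi' -hi; ring.
Qed.

Hypothesis p_not_root1 : forall k, 1 - p ^+ k.+1 != 0.

Lemma qfact_neq0 n : qfact n != 0.
Proof. by apply/prodf_neq0 => k _; apply: p_not_root1. Qed.

(** The companion Pascal rule, from the opposite splitting of [1 - p^(i+m+2)]. The triple product
    needs both: this one to add factors of the second product, the defining one for the first. *)
Lemma gauss_binom_pascal N i :
  gauss_binom N.+1 i.+1 = gauss_binom N i + p ^+ i.+1 * gauss_binom N i.+1.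
Proof.
have [lt_Ni|le_iN] := ltnP N i.
  by rewrite !gauss_binom_small ?mulr0 ?addr0 //; lia.
have [m ->] : exists m, N = (i + m)%N by exists (N - i)%N; lia.
case: m => [|m].
  rewrite addn0 (gauss_binom_small (ltnSn i)) mulr0 addr0 /=.
  by rewrite subnn mul1r gauss_binom_small ?add0r.
apply: (mulIf (mulf_neq0 (qfact_neq0 i.+1) (qfact_neq0 m.+1))).
have := gauss_binom_qfact i.+1 m.+1.
have := gauss_binom_qfact i m.+1.
have := gauss_binom_qfact i.+1 m.
rewrite addSnnS addSn [qfact (i + m.+1).+1]qfactS => h1 h2 ->; move: h1 h2.
set Q := qfact (i + m.+1); rewrite -addSn exprD !qfactS => h1 h2.
transitivity ((1 - p ^+ i.+1) * Q + p ^+ i.+1 * (1 - p ^+ m.+1) * Q); first by ring.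
by rewrite -{1}h2 -h1; ring.
Qed.

End GaussBinomial.

(** Since [j (j + 1)] is even and nonnegative for every integer [j], neither the absolute value nor
    the halving loses anything. *)
Definition tri (j : int) : nat := (`|(j * (j + 1))%R|./2)%N.

Lemma triE (j : int) : 2 * (tri j)%:Z = j * (j + 1).
Proof.
rewrite /tri; case: j => n.
  have : ~~ odd (n * n.+1) by rewrite oddM /=; case: odd.
  nia.
have : ~~ odd (n * n.+1) by rewrite oddM /=; case: odd.
rewrite NegzE; nia.
Qed.

Lemma triS (j : int) : (tri (j + 1))%:Z = (tri j)%:Z + j + 1.
Proof. have := triE j; have := triE (j + 1); nia. Qed.

Lemma triNS (j : int) : (tri (- j))%:Z = (tri (- (j + 1)))%:Z - j.
Proof. have := triE (- j); have := triE (- (j + 1)); nia. Qed.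

(* The exponent of [q] in the [j]-th term
   [x ^ (j (j + 1) / 2) * y ^ (j (j - 1) / 2)] of Ramanujan's theta function
   [f(x, y)], at [x = c q ^ al] and [y = c q ^ be]. *)
Definition theta_exp (al be : nat) (j : int) : nat :=
  (al * tri j + be * tri (- j))%N.

Lemma theta_expS al be j :
  (theta_exp al be (j + 1))%:Z =
  (theta_exp al be j)%:Z + (al + be)%N%:Z * j + al%:Z.
Proof.
have := triS j; have := triNS j; rewrite /theta_exp !PoszD !PoszM => h1 ->.
have -> : (tri (- (j + 1)))%:Z = (tri (- j))%:Z + j by rewrite h1; ring.
ring.
Qed.

Lemma theta_expE al be j :
  2 * (theta_exp al be j)%:Z = (al + be)%N%:Z * j ^+ 2 + (al%:Z - be%:Z) * j.
Proof.
rewrite /theta_exp !PoszD !PoszM mulrDr !(mulrCA 2) !triE; ring.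
Qed.

Lemma theta_exp_ge al be j : (0 < al)%N -> (0 < be)%N ->
  (`|j| <= theta_exp al be j)%N.
Proof.
move=> al0 be0; have := triE j; have := triE (- j).
(* The left-hand side equals [j^2]. *)
have : (tri j + tri (- j) <= theta_exp al be j)%N.
  by rewrite /theta_exp leq_add // leq_pmull.
nia.
Qed.

(** * The triple product with sign [c]: finite form, then modulo powers of ['X] *)

Section JacobiTripleProduct.
Variables (F : fieldType) (c : F) (al be : nat).
Hypotheses (c2 : c * c = 1) (al0 : (0 < al)%N) (be0 : (0 < be)%N).

Let p : nat := (al + be)%N.

(** As [c] is its own inverse, the exponent [|j|] gives [c^j] for negative [j] too. *)
Definition theta_term (j : int) : {poly F} :=
  c ^+ `|j|%N *: 'X^(theta_exp al be j).

(** This is [(- c q^e; q^d)_n] at [q = 'X]. *)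
Definition qpoch_poly (e d n : nat) : {poly F} :=
  \prod_(k < n) (1 + c *: 'X^(e + d * k)).

Lemma qpoch_polyS e d n :
  qpoch_poly e d n.+1 = qpoch_poly e d n * (1 + c *: 'X^(e + d * n)).
Proof. by rewrite /qpoch_poly big_ord_recr. Qed.

Lemma sign_absS (j : int) : c ^+ `|(j + 1)%R|%N = c * c ^+ `|j|%N.
Proof.
have [j_ge0|j_lt0] := leP 0 j.
  by rewrite (_ : `|(j + 1)%R|%N = `|j|%N.+1) ?exprS //; lia.
rewrite (_ : `|j|%N = `|(j + 1)%R|%N.+1); last by lia.
by rewrite exprS mulrA c2 mul1r.
Qed.

(** A new factor of the first product shifts the theta index up by one; the power of ['X^p] left
    over is the weight in the defining Pascal rule. *)
Lemma theta_term_mull (a b i : nat) : (i <= a + b)%N ->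
  theta_term (i%:Z - b%:Z) * (c *: 'X^(al + p * a)) =
  'X^p ^+ (a + b - i) * theta_term (i.+1%:Z - b%:Z).
Proof.
move=> le_i; rewrite /theta_term.
have -> : i.+1%:Z - b%:Z = i%:Z - b%:Z + 1 by lia.
rewrite sign_absS -exprM -!scalerAl -!scalerAr -!exprD scalerA mulrC.
congr (_ *: 'X^_).
have := theta_expS al be (i%:Z - b%:Z); rewrite -/p.
set e1 := theta_exp _ _ _; set e0 := theta_exp _ _ _; move: e1 e0 => e1 e0 he.
suff : (e0 + (al + p * a))%N%:Z = (p * (a + b - i) + e1)%N%:Z by case.
rewrite !PoszD !PoszM he -subzn //; ring.
Qed.

Lemma theta_term_mulr (b i : nat) :
  theta_term (i%:Z - b%:Z) * (c *: 'X^(be + p * b)) =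
  'X^p ^+ i * theta_term (i%:Z - b.+1%:Z).
Proof.
rewrite /theta_term.
have -> : i%:Z - b%:Z = i%:Z - b.+1%:Z + 1 by lia.
rewrite sign_absS -exprM -!scalerAl -!scalerAr -!exprD scalerA mulrAC c2 mul1r.
congr (_ *: 'X^_).
have := theta_expS al be (i%:Z - b.+1%:Z); rewrite -/p.
set e1 := theta_exp _ _ _; set e0 := theta_exp _ _ _; move: e1 e0 => e1 e0 he.
suff : (e1 + (be + p * b))%N%:Z = (p * i + e0)%N%:Z by case.
rewrite !PoszD !PoszM he /p !PoszD (intS b); ring.
Qed.


Lemma subr_Xn_neq0 k : 1 - 'X^p ^+ k.+1 != 0 :> {poly F}.
Proof.
rewrite subr_eq0 -exprM; apply/eqP => /(congr1 (fun f : {poly F} => size f)).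
by rewrite size_poly1 size_polyXn /p; nia.
Qed.

Notation gb := (gauss_binom ('X^p : {poly F})).

(** The case [a = 0] of the finite triple product. New factors shift the theta index down, which
    calls for the companion Pascal rule. *)
Lemma jtp_one_sided b :
  qpoch_poly be p b = \sum_(i < b.+1) gb b i * theta_term (i%:Z - b%:Z).
Proof.
elim: b => [|b IH].
  by rewrite /qpoch_poly big_ord0 big_ord1 /= mul1r /theta_term /theta_exp /= !muln0 scale1r.
rewrite qpoch_polyS IH mulrDr mulr1 mulr_suml.
rewrite [in RHS]big_ord_recl gauss_binom0 mul1r.
under [in RHS]eq_bigr => i _ do rewrite lift0 (gauss_binom_pascal subr_Xn_neq0) mulrDl.
rewrite big_split /= addrCA; congr (_ + _).
  by apply: eq_bigr => i _; congr (_ * theta_term _); lia.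
under eq_bigr => i _ do rewrite -mulrA theta_term_mulr.
rewrite big_ord_recl big_ord_recr /= gauss_binom0 mul1r expr0 mul1r.
rewrite (gauss_binom_small _ (ltnSn b)) mulr0 mul0r addr0; congr (_ + _).
by apply: eq_bigr => i _; rewrite /bump leq0n add1n; ring.
Qed.

Lemma finite_jtp a b :
  qpoch_poly al p a * qpoch_poly be p b =
  \sum_(i < (a + b).+1) gb (a + b) i * theta_term (i%:Z - b%:Z).
Proof.
elim: a => [|a IH].
  by rewrite [qpoch_poly al p 0]big_ord0 mul1r jtp_one_sided.
rewrite qpoch_polyS mulrAC IH mulrDr mulr1 mulr_suml addSn.
rewrite [in RHS]big_ord_recl gauss_binom0 mul1r.
under [in RHS]eq_bigr => i _ do rewrite lift0 /= mulrDl.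
rewrite big_split /= addrA; congr (_ + _); last first.
  apply: eq_bigr => i _; rewrite -[LHS]mulrA theta_term_mull; last by rewrite -ltnS.
  by rewrite mulrCA mulrA.
rewrite big_ord_recl gauss_binom0 mul1r; congr (_ + _).
rewrite [in RHS]big_ord_recr /= gauss_binom_small // mul0r addr0.
by apply: eq_bigr => i _; rewrite /bump leq0n add1n.
Qed.

(** The factors beyond the [m]-th are 1 modulo ['X^(p * m.+1)]. *)
Lemma dvdp_qfact_sub m l : (m <= l)%N ->
  'X^(p * m.+1) %| qfact ('X^p : {poly F}) l - qfact 'X^p m.
Proof.
elim: l => [|l IH] le_ml.
  by rewrite (_ : m = 0%N) ?subrr ?dvdp0 //; lia.
move: le_ml; rewrite leq_eqVlt => /predU1P[->|lt_ml]; first by rewrite subrr dvdp0.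
rewrite qfactS mulrBr mulr1 addrAC dvdp_sub ?IH // dvdp_mull // -exprM.
by rewrite dvdp_exp2l // leq_mul2l lt_ml orbT.
Qed.

Lemma qfact_horner0 n : (qfact ('X^p : {poly F}) n).[0] = 1.
Proof.
rewrite /qfact horner_prod big1 // => k _.
rewrite -exprM !(hornerE, hornerXn) expr0n.
by rewrite (_ : (_ == 0%N) = false) ?subr0 // /p; nia.
Qed.

Lemma coprimep_Xn_qfact m n : coprimep 'X^m (qfact ('X^p : {poly F}) n).
Proof.
rewrite coprimep_expl // coprimep_sym.
have := coprimep_XsubC (qfact ('X^p : {poly F}) n) 0.
by rewrite subr0 /root qfact_horner0 oner_neq0.
Qed.

(** With [m] the smaller of [i] and [2n - i], the binomial is [(2n)! / (m! (2n - m)!)] in [qfact]s,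
    all congruent to [qfact m] at this precision. Multiplying by [qfact m], coprime to ['X], clears
    the denominator. *)
Lemma dvdp_gauss_binom n i : (i <= n + n)%N ->
  'X^(p * (minn i (n + n - i)).+1) %|
    gb (n + n) i * qfact ('X^p : {poly F}) n - 1.
Proof.
move=> le_i; set m := minn _ _.
have Hm : gb (n + n) i * (qfact 'X^p m * qfact 'X^p (n + n - m)%N) = qfact 'X^p (n + n)%N.
  have := gauss_binom_qfact ('X^p : {poly F}) i (n + n - i); rewrite subnKC // => <-.
  congr (_ * _); rewrite /m /minn; case: ifP => // _.
  by rewrite mulrC subKn.
rewrite -(Gauss_dvdpl _ (coprimep_Xn_qfact _ m)).
have -> : (gb (n + n) i * qfact 'X^p n - 1) * qfact 'X^p m =
    gb (n + n) i * qfact 'X^p m *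
      ((qfact 'X^p n - qfact 'X^p m) - (qfact 'X^p (n + n - m)%N - qfact 'X^p m))
    + (qfact 'X^p (n + n)%N - qfact 'X^p m).
  by rewrite -Hm; ring.
have [le_mn le_mn' le_m2n] : [/\ m <= n, m <= n + n - m & m <= n + n]%N.
  by rewrite /m; split; lia.
apply: dvdp_add; last exact: dvdp_qfact_sub.
by apply/dvdp_mull/dvdp_sub; apply: dvdp_qfact_sub.
Qed.

Definition theta_poly n : {poly F} :=
  \sum_(i < (n + n).+1) theta_term (i%:Z - n%:Z).

(** The binomial in term [i] is accurate to order [p (n - |i - n| + 1)], and the theta term adds
    order at least [|i - n|]; together they reach [n]. *)
Lemma jtp_mod_Xn n :
  'X^n %| qpoch_poly al p n * qpoch_poly be p n * qfact 'X^p n - theta_poly n.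
Proof.
rewrite finite_jtp mulr_suml -sumrB.
apply: (big_ind (fun f => 'X^n %| f)) => [|f g|i _]; rewrite ?dvdp0 //.
  exact: dvdp_add.
have le_i : (i <= n + n)%N by rewrite -ltnS.
rewrite mulrAC -[X in _ - X]mul1r -mulrBl.
apply: dvdp_trans (dvdp_mul (dvdp_gauss_binom le_i) (dvdpp _)).
rewrite /theta_term -scalerAr dvdpZr; last first.
  by rewrite expf_neq0 //; apply: contra_eq_neq c2 => ->; rewrite mul0r eq_sym oner_neq0.
rewrite -exprD dvdp_exp2l //.
have := theta_exp_ge (i%:Z - n%:Z) al0 be0.
set e := theta_exp _ _ _; move: le_i; rewrite /p /minn.
case: ifP => _; nia.
Qed.

End JacobiTripleProduct.

(** * Cancellation in the theta series *)

Lemma dvdXnP (F : fieldType) n (f : {poly F}) :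
  reflect (forall i, (i < n)%N -> f`_i = 0) ('X^n %| f).
Proof.
apply: (iffP idP) => [/dvdpP[g ->] i lt_in|f0].
  by rewrite coefMXn lt_in.
apply/dvdpP; exists (\poly_(i < size f) f`_(i + n)).
apply/polyP => i; rewrite coefMXn; case: ltnP => [/f0 //|le_ni].
rewrite coef_poly subnK //; case: ltnP => // le_fi.
by rewrite nth_default // (leq_trans le_fi) ?leq_subr.
Qed.

(** * Cancelling a factor that is a polynomial in ['X^d] *)

Section SupportModulus.
Variables (F : fieldType) (d : nat).

Definition supp_dvd (f : {poly F}) := forall i, ~~ (d %| i)%N -> f`_i = 0.

Lemma supp_dvdM f g : supp_dvd f -> supp_dvd g -> supp_dvd (f * g).
Proof.
move=> hf hg i ndi; rewrite coefM big1 // => j _.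
have [dj|/hf ->] := boolP (d %| j)%N; last by rewrite mul0r.
by rewrite hg ?mulr0 // -(dvdn_addl _ dj) subnK // -ltnS.
Qed.

Lemma supp_dvd_qfact e n : (d %| e)%N -> supp_dvd (qfact 'X^e n).
Proof.
move=> de; elim: n => [|n IH].
  by rewrite qfact0 => -[|i] ndi; rewrite ?coef1 // dvdn0 in ndi *.
rewrite qfactS; apply: supp_dvdM => // i ndi.
rewrite -exprM coefB coef1 coefXn.
have -> : (i == 0%N) = false by apply: contraNF ndi => /eqP ->; rewrite dvdn0.
have -> : (i == e * n.+1)%N = false.
  by apply: contraNF ndi => /eqP ->; rewrite dvdn_mulr.
by rewrite subr0.
Qed.

Lemma coef_supp_dvd_cancel (f g : {poly F}) n r :
    supp_dvd g -> g`_0 != 0 ->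
    (forall m, (m < n)%N -> m = r %[mod d] -> (f * g)`_m = 0) ->
  forall m, (m < n)%N -> m = r %[mod d] -> f`_m = 0.
Proof.
move=> hg g0 hfg; elim/ltn_ind => m IH lt_mn mr.
have := hfg m lt_mn mr; rewrite coefM big_ord_recr /= subnn big1 ?add0r.
  by move/eqP; rewrite mulf_eq0 (negPf g0) orbF => /eqP.
move=> i _; have [dmi|/hg ->] := boolP (d %| m - i)%N; last by rewrite mulr0.
have lt_im := ltn_ord i.
rewrite IH ?mul0r //; first by apply: ltn_trans lt_mn.
by rewrite -mr; apply/eqP; rewrite eq_sym eqn_mod_dvd // ltnW.
Qed.

End SupportModulus.

(** * The sign-reversing involution, for both series at once *)

Section ThetaProduct.
Variables (F : numFieldType) (al be al' be' : nat) (del : int) (r : nat).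
Hypotheses (al0 : (0 < al)%N) (be0 : (0 < be)%N).
Hypotheses (al'0 : (0 < al')%N) (be'0 : (0 < be')%N).
Hypotheses (sum5 : (al + be = 5)%N) (sum10 : (al' + be' = 10)%N).
Let u : int := al%:Z - be%:Z.
Hypothesis slope : al'%:Z - be'%:Z = 3 * u - 5 * del.
Hypothesis del_odd : odd `|del|%N.
(** To be used at [z = a + b + c - 2 * d]: by [slope], twice the exponent is [u * z] modulo 5. *)
Hypothesis residue : forall z : int,
  (exists y : int, u * z - 2 * r%:Z = 5 * y) ->
  exists k : int, 2 * z + del = 5 * k.

Definition quad_exp (a b c d : int) : nat :=
  (theta_exp al be a + theta_exp al be b + theta_exp al be c
   + theta_exp al' be' d)%N.

(** The division is exact on exponents congruent to [r] modulo 5, the only ones where the value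
    matters. *)
Definition refl_shift (a b c d : int) : int :=
  ((2 * (a + b + c - 2 * d) + del) %/ 5)%Z.

Lemma quad_expE a b c d :
  2 * (quad_exp a b c d)%:Z =
  5 * (a ^+ 2 + b ^+ 2 + c ^+ 2 + 2 * d ^+ 2) + u * (a + b + c)
  + (3 * u - 5 * del) * d.
Proof.
have := theta_expE al be a; have := theta_expE al be b.
have := theta_expE al be c; have := theta_expE al' be' d.
rewrite /quad_exp sum5 sum10 slope -/u.
move: (theta_exp al be a) (theta_exp al be b) (theta_exp al be c) => ea eb ec.
move: (theta_exp al' be' d) => ed hd hc hb ha.
rewrite !PoszD !mulrDr ha hb hc hd; lia.
Qed.

Lemma refl_shiftE a b c d : quad_exp a b c d = r %[mod 5] ->
  5 * refl_shift a b c d = 2 * (a + b + c - 2 * d) + del.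
Proof.
move=> er; suff [k hk] : exists k, 2 * (a + b + c - 2 * d) + del = 5 * k.
  by rewrite /refl_shift hk mulKz.
apply: residue.
have := quad_expE a b c d; move: (quad_exp a b c d) er => E er hE.
have [y hy] : exists y, E%:Z - r%:Z = 5 * y.
  exists ((E %/ 5)%N%:Z - (r %/ 5)%N%:Z).
  rewrite [in LHS](divn_eq E 5) [in LHS](divn_eq r 5) er; lia.
exists (2 * y - (a ^+ 2 + b ^+ 2 + c ^+ 2 + 2 * d ^+ 2) + del * d - u * d).
have -> : 2 * r%:Z = 2 * E%:Z - 2 * (5 * y) by lia.
by rewrite hE; ring.
Qed.

(* [(a, b, c, d) |-> (a - k, b - k, c - k, d + k)] is the reflection in the
   vector [(1, 1, 1, -1)] for the quadratic form [a^2 + b^2 + c^2 + 2 d^2],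
   centred at the point where the exponent is minimal. *)
Lemma quad_exp_refl a b c d : quad_exp a b c d = r %[mod 5] ->
  let k := refl_shift a b c d in
  quad_exp (a - k) (b - k) (c - k) (d + k) = quad_exp a b c d.
Proof.
move=> /refl_shiftE /=; set k := refl_shift _ _ _ _ => hk.
suff : 2 * (quad_exp (a - k) (b - k) (c - k) (d + k))%:Z =
       2 * (quad_exp a b c d)%:Z by lia.
apply/eqP; rewrite -subr_eq0 !quad_expE; apply/eqP.
(* The second factor is zero by the equation that defines [k]. *)
transitivity (5 * k * (5 * k - (2 * (a + b + c - 2 * d) + del))); first by ring.
by rewrite hk subrr mulr0.
Qed.

(** The reflection lowers [a + b + c - 2 * d] by [5 * k], so [5 * k] becomes [5 * k - 10 * k]. This
    makes the map an involution. *)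
Lemma refl_shift_refl a b c d : quad_exp a b c d = r %[mod 5] ->
  let k := refl_shift a b c d in
  refl_shift (a - k) (b - k) (c - k) (d + k) = - k.
Proof.
move=> /refl_shiftE /=; set k := refl_shift _ _ _ _ => hk.
rewrite /refl_shift (_ : _ + del = - k * 5) ?mulzK //.
transitivity (2 * (a + b + c - 2 * d) + del - 10 * k); first by ring.
by rewrite -hk; ring.
Qed.

(** As [del] is odd, so is [k], and three odd shifts change the parity. *)
Lemma refl_shift_sign a b c d : quad_exp a b c d = r %[mod 5] ->
  let k := refl_shift a b c d in
  odd (`|(a - k)%R| + `|(b - k)%R| + `|(c - k)%R|)%N =
  ~~ odd (`|a| + `|b| + `|c|)%N.
Proof. move=> /refl_shiftE /=; set k := refl_shift _ _ _ _ => hk; lia. Qed.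

Lemma quad_exp_ge a b c d m : quad_exp a b c d = m ->
  [/\ `|a| <= m, `|b| <= m, `|c| <= m & `|d| <= m]%N.
Proof.
have := theta_exp_ge a al0 be0; have := theta_exp_ge b al0 be0.
have := theta_exp_ge c al0 be0; have := theta_exp_ge d al'0 be'0.
by rewrite /quad_exp => ? ? ? ? <-; split; lia.
Qed.

Lemma coef_theta_prod n m : (m < n)%N -> m = r %[mod 5] ->
  (theta_poly (-1 : F) al be n ^+ 3 * theta_poly 1 al' be' n)`_m = 0.
Proof.
move=> lt_mn mr.
pose I := 'I_(n + n).+1.
pose z (i : I) : int := i%:Z - n%:Z.
pose z' (x : int) : I := inord `|(x + n%:Z)%R|%N.
have zK : cancel z z' by move=> i; rewrite /z /z' subrK absz_nat inord_val.
have z'K x : (`|x| <= m)%N -> z (z' x) = x.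
  by move=> le_xm; rewrite /z /z' inordK; lia.
pose E (v : I * I * I * I) :=
  quad_exp (z v.1.1.1) (z v.1.1.2) (z v.1.2) (z v.2).
pose sg (v : I * I * I * I) : F :=
  (-1) ^+ (`|z v.1.1.1| + `|z v.1.1.2| + `|z v.1.2|)%N.
pose K (v : I * I * I * I) :=
  refl_shift (z v.1.1.1) (z v.1.1.2) (z v.1.2) (z v.2).
(* The reflection on the terms of exponent [m], the identity elsewhere. It stays in the box of
   indices because an exponent [m < n] bounds all four of them by [m]. *)
pose phi v : I * I * I * I := if E v == m then
  (z' (z v.1.1.1 - K v), z' (z v.1.1.2 - K v), z' (z v.1.2 - K v),
   z' (z v.2 + K v)) else v.
have phiE v : E v = m ->
  [/\ z (phi v).1.1.1 = z v.1.1.1 - K v, z (phi v).1.1.2 = z v.1.1.2 - K v,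
      z (phi v).1.2 = z v.1.2 - K v & z (phi v).2 = z v.2 + K v].
  move=> Ev; rewrite /phi Ev eqxx /=.
  have Er : E v = r %[mod 5] by rewrite Ev.
  have := quad_exp_refl Er; rewrite -/(K v) -/(E v) Ev => /quad_exp_ge[].
  by move=> ? ? ? ?; rewrite !z'K.
have E_phi v : E v = m -> E (phi v) = m.
  move=> Ev; have [e1 e2 e3 e4] := phiE v Ev; rewrite /E e1 e2 e3 e4.
  by rewrite quad_exp_refl // -/(E v) Ev.
have phiK : involutive phi.
  move=> v; have [Ev|nEv] := eqVneq (E v) m; last first.
    have pv : phi v = v by rewrite /phi (negPf nEv).
    by rewrite !pv.
  have Epv := E_phi _ Ev; have [e1 e2 e3 e4] := phiE v Ev.
  have Kpv : K (phi v) = - K v.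
    by rewrite {1}/K e1 e2 e3 e4 refl_shift_refl // -/(E v) Ev.
  rewrite {1}/phi Epv eqxx Kpv e1 e2 e3 e4 !opprK !subrK addrK !zK.
  by case: v {Ev Epv e1 e2 e3 e4 Kpv} => [[[a b] c] d].
have sg_phi v : E v = m -> sg (phi v) = - sg v.
  move=> Ev; have [e1 e2 e3 e4] := phiE v Ev; rewrite /sg e1 e2 e3.
  rewrite -signr_odd refl_shift_sign -/(E v) ?Ev // signrN signr_odd.
  by [].
have -> : (theta_poly (-1 : F) al be n ^+ 3 * theta_poly 1 al' be' n)`_m =
    \sum_v sg v * (m == E v)%:R.
  rewrite /theta_poly (exprSr _ 2) expr2.
  do 3![rewrite big_distrlr pair_bigA /=].
  rewrite coef_sum; apply: eq_bigr => v _.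
  rewrite /theta_term !expr1n -!(scalerAl, scalerAr) !scalerA -!exprD mul1r coefZ coefXn.
  by congr (_ ^+ _ * _); rewrite -addnA addnC.
(* Reindexing by [phi] negates the sum, which is therefore 0 in characteristic 0. *)
set S := \sum_v _; suff : - S = S by move/eqP; rewrite eqNr => /eqP.
rewrite [in RHS]/S (reindex_inj (inv_inj phiK)) /S -sumrN; apply: eq_bigr => v _.
have [Ev|nEv] := eqVneq (E v) m.
  by rewrite (E_phi _ Ev) eqxx sg_phi // mulNr.
have pv : phi v = v by rewrite /phi (negPf nEv).
by rewrite pv eq_sym (negPf nEv) mulr0 oppr0.
Qed.

Lemma coef_qpoch_prod n m : (m < n)%N -> m = r %[mod 5] ->
  ((qpoch_poly (-1 : F) al 5 n * qpoch_poly (-1) be 5 n) ^+ 3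
   * (qpoch_poly 1 al' 10 n * qpoch_poly 1 be' 10 n))`_m = 0.
Proof.
pose Q5 := qfact ('X^5 : {poly F}) n; pose Q10 := qfact ('X^10 : {poly F}) n.
apply: (coef_supp_dvd_cancel (g := Q5 ^+ 3 * Q10) (n := n) (r := r)) m => [||m lt_mn mr].
- rewrite !exprS expr0 mulr1.
  by do !apply: supp_dvdM; apply: supp_dvd_qfact.
- have h5 := qfact_horner0 F al0 be0 n; have h10 := qfact_horner0 F al'0 be'0 n.
  rewrite sum5 in h5; rewrite sum10 in h10.
  by rewrite -horner_coef0 hornerM horner_exp h5 h10 expr1n mulr1 oner_neq0.
have NN1 : -1 * -1 = 1 :> F by rewrite mulrNN mulr1.
have /dvdpP[gA hA] := jtp_mod_Xn NN1 al0 be0 n.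
have /dvdpP[gB hB] := jtp_mod_Xn (mulr1 (1 : F)) al'0 be'0 n.
rewrite sum5 in hA; rewrite sum10 in hB.
move: (coef_theta_prod lt_mn mr) hA hB.
set A := qpoch_poly _ al _ _; set B := qpoch_poly _ be _ _.
set A' := qpoch_poly _ al' _ _; set B' := qpoch_poly _ be' _ _.
set T := theta_poly _ al be n; set T' := theta_poly _ al' be' n.
move=> hT /eqP; rewrite subr_eq -/Q5 => /eqP hA /eqP.
rewrite subr_eq -/Q10 => /eqP hB.
(* The expansion of [(T + gA * 'X^n) ^+ 3 * (T' + gB * 'X^n)], sorted by divisibility by ['X^n]. *)
have -> : (A * B) ^+ 3 * (A' * B') * (Q5 ^+ 3 * Q10)
    = T ^+ 3 * T' + (gA * (3 * T ^+ 2 + 3 * T * (gA * 'X^n) + (gA * 'X^n) ^+ 2)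
                       * (gB * 'X^n + T') + T ^+ 3 * gB) * 'X^n.
  transitivity ((A * B * Q5) ^+ 3 * (A' * B' * Q10)); first by ring.
  by rewrite hA hB; ring.
by rewrite coefD hT coefMXn lt_mn addr0.
Qed.

End ThetaProduct.

(** * Comparison of coefficients *)

Local Open Scope complex_scope.

Lemma cvg_real_complex (R : realType) (u : R^nat) (l : R) :
  (fun n => ((u n)%:C : Cplx R)) @ \oo --> (l%:C : Cplx R) <-> u @ \oo --> l.
Proof.
have distC n : `|(l%:C : Cplx R) - (u n)%:C| = `|l - u n|%:C.
  by rewrite -rmorphB normc_def /= expr0n addr0 sqrtr_sqr.
split=> /cvgrPdist_lt h; apply/cvgrPdist_lt => e e0.
  have := h e%:C; rewrite ltcR => /(_ e0); apply: filterS => n.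
  by rewrite distC ltcR.
(* A positive complex number is real. *)
move: e0; rewrite ltcE /= => /andP[/eqP Ime Ree].
have -> : e = (complex.Re e)%:C by case: e Ime {Ree} => a b /= ->.
have := h _ Ree; apply: filterS => n.
by rewrite distC ltcR.
Qed.

Lemma cvg_dist_le (R : realType) (u : R^nat) (l b K : R) n :
  u @ \oo --> l -> (forall m, (n <= m)%N -> `|u m - b| <= K) -> `|l - b| <= K.
Proof.
move=> /cvgrPdist_lt h hK; apply/ler_addgt0Pr => e e0.
have [N _ hN] := h e e0.
have h1 := hN (N + n)%N (leq_addr _ _); have h2 := hK (N + n)%N (leq_addl _ _).
rewrite /= in h1.
apply: le_trans (ler_distD (u (N + n)%N) _ _) _.
by rewrite addrC lerD // ltW.
Qed.

(** * Convergence of the infinite products at small real arguments *)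

Section PartialProducts.
Variables (R : realType) (a p x : R).
Hypotheses (x_gt0 : 0 < x) (x_le : x <= 4^-1).
Hypotheses (ax : `|a| <= x) (px : `|p| <= x).

Definition qpoch_part (n : nat) : R := \prod_(0 <= k < n) (1 - a * p ^+ k).

Lemma qpoch_partS n :
  qpoch_part n.+1 = qpoch_part n * (1 - a * p ^+ n).
Proof. by rewrite /qpoch_part big_nat_recr. Qed.

Let xn_gt0 n : 0 < x ^+ n. Proof. exact: exprn_gt0. Qed.

Lemma norm_factor_le n : `|a * p ^+ n| <= x ^+ n.+1.
Proof.
by rewrite normrM normrX exprS ler_pM // lerXn2r // nnegrE ?normr_ge0 ltW.
Qed.

(** The bound is shaped for the induction: [(2 - t) (1 + x t) <= 2 - x t] for [t = x^n], as
    [x <= 1/4]. *)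
Lemma norm_qpoch_part_le n : `|qpoch_part n| <= 2 - x ^+ n.
Proof.
elim: n => [|n IH]; first by rewrite /qpoch_part big_nil normr1 expr0; lra.
rewrite qpoch_partS normrM.
have h1 : `|1 - a * p ^+ n| <= 1 + x ^+ n.+1.
  apply: le_trans (ler_normB _ _) _; rewrite normr1 lerD2l.
  exact: norm_factor_le.
apply: le_trans (ler_pM _ _ IH h1) _ => //.
rewrite exprS; have := xn_gt0 n; move: (x ^+ n) => t t0.
have h2 : x * t <= 4^-1 * t by rewrite ler_pM2r.
have h3 : 0 <= x * t * t by rewrite !mulr_ge0 // ltW.
nra.
Qed.

Lemma qpoch_part_step n :
  `|qpoch_part n.+1 - qpoch_part n| <= x ^+ n - x ^+ n.+1.
Proof.
rewrite qpoch_partS mulrBr mulr1 addrC addKr normrN normrM.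
apply: le_trans (ler_pM _ _ (norm_qpoch_part_le n) (norm_factor_le n)) _ => //.
rewrite exprS; have := xn_gt0 n; move: (x ^+ n) => t t0.
have h2 : x * t <= 4^-1 * t by rewrite ler_pM2r.
have h3 : 0 <= x * t * t by rewrite !mulr_ge0 // ltW.
nra.
Qed.

Lemma qpoch_part_dist n m : (n <= m)%N ->
  `|qpoch_part m - qpoch_part n| <= x ^+ n - x ^+ m.
Proof.
elim: m => [|m IH].
  by rewrite leqn0 => /eqP ->; rewrite !subrr normr0.
rewrite leq_eqVlt => /predU1P[->|/IH{}IH]; first by rewrite !subrr normr0.
apply: le_trans (ler_distD (qpoch_part m) _ _) _.
by have := qpoch_part_step m; lra.
Qed.

Lemma is_cvg_qpoch_part : cvgn qpoch_part.
Proof.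
(* The telescoping bound on the increments makes [v] nonincreasing. *)
pose v n := qpoch_part n + x ^+ n.
have cv : cvgn v.
  apply: nonincreasing_is_cvgn.
    by move=> n m /qpoch_part_dist; rewrite /v ler_norml => /andP[_]; lra.
  exists (-2) => _ [n _ <-]; rewrite /v.
  have := norm_qpoch_part_le n; rewrite ler_norml => /andP[+ _].
  by have := xn_gt0 n; lra.
have -> : qpoch_part = v - (fun n => x ^+ n).
  by apply/funext => n; rewrite /v fctE /= addrK.
have x_lt1 : x < 1 by have := x_le; lra.
apply: is_cvgB => //; apply/cvg_ex; exists 0; apply: cvg_expr.
by rewrite gtr0_norm.
Qed.

Lemma qpoch_part_lim_dist n : `|limn qpoch_part - qpoch_part n| <= x ^+ n.
Proof.
apply: (@cvg_dist_le _ qpoch_part _ _ _ n is_cvg_qpoch_part) => m /qpoch_part_dist.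
by have := xn_gt0 m; lra.
Qed.

Lemma qpoch_inf_real :
  qpoch_inf (a%:C : Cplx R) (p%:C) = (limn qpoch_part)%:C.
Proof.
have eq_part : (fun n => \prod_(0 <= k < n) (1 - (a%:C : Cplx R) * p%:C ^+ k)) =
    (fun n => (qpoch_part n)%:C).
  apply/funext => n; rewrite rmorph_prod; apply: eq_bigr => k _.
  by rewrite rmorphB rmorph1 rmorphM rmorphXn.
rewrite /qpoch_inf eq_part; apply: cvg_lim => //.
by apply/cvg_real_complex; apply: is_cvg_qpoch_part.
Qed.

End PartialProducts.

(** * Polynomial approximation to order [n] at the origin *)

Section Approximation.
Variable R : realType.

(** The relation [g = G + O(x^n)] on a fixed interval. The bound 1/8 is half of the 1/4 at which
    series are assumed to converge, so that their tails are geometric. *)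
Definition approx (n : nat) (g : R -> R) (G : {poly R}) : Prop :=
  exists K : R, forall x : R, 0 < x -> x <= 8^-1 -> `|g x - G.[x]| <= K * x ^+ n.

Lemma poly_bounded (G : {poly R}) :
  exists2 B : R, 0 <= B & forall x : R, 0 < x -> x <= 8^-1 -> `|G.[x]| <= B.
Proof.
exists (\sum_(i < size G) `|G`_i|); first by rewrite sumr_ge0.
move=> x x0 x8; rewrite horner_coef.
apply: le_trans (ler_norm_sum _ _ _) _; apply: ler_sum => i _.
by rewrite normrM ler_piMr // normrX exprn_ile1 // gtr0_norm //; lra.
Qed.

Lemma approxM n g h G H :
  approx n g G -> approx n h H -> approx n (fun x => g x * h x) (G * H).
Proof.
move=> [K hK] [L hL].
have [B B0 hB] := poly_bounded G; have [C C0 hC] := poly_bounded H.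
exists (`|K| * (C + `|L|) + B * `|L|) => x x0 x8.
have xn0 : 0 < x ^+ n by apply: exprn_gt0.
have xn1 : x ^+ n <= 1 by apply: exprn_ile1; lra.
have hg : `|g x - G.[x]| <= `|K| * x ^+ n.
  by apply: le_trans (hK x x0 x8) _; rewrite ler_pM2r // ler_norm.
have hh : `|h x - H.[x]| <= `|L| * x ^+ n.
  by apply: le_trans (hL x x0 x8) _; rewrite ler_pM2r // ler_norm.
have hh' : `|h x| <= C + `|L|.
  rewrite -[h x](subrK H.[x]) addrC; apply: le_trans (ler_normD _ _) _.
  rewrite lerD ?hC //; apply: le_trans hh _.
  by rewrite ler_piMr.
rewrite hornerM.
have -> : g x * h x - G.[x] * H.[x] =
    (g x - G.[x]) * h x + G.[x] * (h x - H.[x]) by ring.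
apply: le_trans (ler_normD _ _) _; rewrite !normrM mulrDl lerD //.
  by rewrite mulrAC ler_pM.
by rewrite -mulrA ler_pM // hB.
Qed.

(** Small [x] forces the constant term to vanish; dividing by [x] then lowers [n]. *)
Lemma poly_small_dvdXn n (D : {poly R}) (K : R) :
  (forall x : R, 0 < x -> x <= 8^-1 -> `|D.[x]| <= K * x ^+ n) -> 'X^n %| D.
Proof.
elim: n D K => [|n IH] D K hD; first by rewrite expr0 dvd1p.
have [D1 [c eD]] : exists (D1 : {poly R}) c, D = D1 * 'X + c%:P.
  by elim/poly_ind: (D) => [|p c _]; [exists 0, 0; rewrite mul0r add0r | exists p, c].
have [B B0 hB] := poly_bounded D1.
have c0 : c = 0.
  apply/eqP; rewrite -normr_le0 leNgt; apply/negP => c_gt0.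
  have KB_gt0 : 0 < `|K| + B + `|c|.
    by rewrite ltr_wpDl // addr_ge0.
  (* Chosen so that [x <= 1/8] and [|K| x + B x <= |c| / 8], whereas [|c| <= |K| x + B x]. *)
  pose x : R := `|c| / (8 * (`|K| + B + `|c|)).
  have x0 : 0 < x by rewrite divr_gt0 // mulr_gt0.
  have hx : x * (8 * (`|K| + B + `|c|)) = `|c|.
    by rewrite mulfVK // lt0r_neq0 // mulr_gt0.
  have K0 : 0 <= `|K| by [].
  have x8 : x <= 8^-1.
    by rewrite ler_pdivrMr ?mulr_gt0 // mulKf // lerDr addr_ge0.
  move: x x0 hx x8 => x x0 hx x8.
  have := hD x x0 x8; rewrite eD !hornerE => h1.
  have h2 := hB x x0 x8.
  have h3 : `|c| <= `|D1.[x] * x + c| + `|D1.[x]| * x.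
    rewrite -{1}[c](addKr (D1.[x] * x)) addrC; apply: le_trans (ler_normB _ _) _.
    by rewrite normrM (gtr0_norm x0).
  have h4 : K * x ^+ n.+1 <= `|K| * x.
    apply: (@le_trans _ _ (`|K| * x ^+ n.+1)).
      by rewrite ler_pM2r ?exprn_gt0 // ler_norm.
    rewrite ler_wpM2l // exprS ler_piMr //; first exact: ltW.
    by rewrite exprn_ile1 //; lra.
  have h5 : `|D1.[x]| * x <= B * x by rewrite ler_pM2r.
  have h6 : 0 < `|c| * x by rewrite mulr_gt0.
  have h7 : 0 <= `|K| * x by rewrite mulr_ge0 // ltW.
  have h8 : 0 <= B * x by rewrite mulr_ge0 // ltW.
  have h9 : `|c| <= `|K| * x + B * x.
    by apply: le_trans h3 _; rewrite lerD // (le_trans h1).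
  move: hx h6 h7 h8 h9; rewrite mulrCA !mulrDr !(mulrC x); lra.
rewrite eD c0 addr0 exprSr dvdp_mul2r ?polyX_eq0 //.
apply: (IH _ K) => x x0 x8.
have := hD x x0 x8; rewrite eD c0 !hornerE normrM (gtr0_norm x0) exprSr mulrA.
by rewrite ler_pM2r.
Qed.

Lemma approx_unique n g G H : approx n g G -> approx n g H -> 'X^n %| G - H.
Proof.
move=> [K hK] [L hL]; apply: (@poly_small_dvdXn _ _ (K + L)) => x x0 x8.
rewrite hornerD hornerN mulrDl.
apply: le_trans (ler_distD (g x) _ _) _.
by rewrite lerD ?hL // distrC hK.
Qed.

Lemma approx_series (s : R^nat) (g : R -> R) n :
  (forall x : R, 0 < x -> x <= 4^-1 -> series (fun m => s m * x ^+ m) @ \oo --> g x) ->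
  approx n g (\poly_(i < n) s i).
Proof.
move=> hs.
(* Convergence at [x = 1/4] bounds the terms there. *)
have [B hB] : exists B, forall m, `|s m| <= B * 4 ^+ m.
  have c4 : cvgn (series (fun m => s m * 4^-1 ^+ m)).
    by apply/cvg_ex; exists (g 4^-1); apply: hs; lra.
  have /cvg_has_ub[B hB] : cvgn (fun m => s m * 4^-1 ^+ m).
    by apply/cvg_ex; exists 0; apply: cvg_series_cvg_0.
  exists B => m; have := hB _ (ex_intro2 _ _ m I erefl).
  rewrite normrM normrX normfV (ger0_norm (_ : 0 <= 4)) // -ler_pdivlMr //.
  by rewrite exprVn invrK.
have B0 : 0 <= B by have := hB 0%N; rewrite expr0 mulr1; apply: le_trans.
exists (2 * B * 4 ^+ n) => x x0 x8.
have xs : series (fun m => s m * x ^+ m) @ \oo --> g x by apply: hs; lra.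
rewrite horner_poly -(big_mkord xpredT (fun i => s i * x ^+ i)).
apply: (@cvg_dist_le _ _ _ _ _ n xs) => m le_nm.
(* Since [4 * x <= 1/2], each term [B (4x)^m] is at most [2 B ((4x)^m - (4x)^(m+1))], and the sum
   telescopes. *)
suff : `|series (fun i => s i * x ^+ i) m - \sum_(0 <= i < n) s i * x ^+ i|
    <= 2 * B * ((4 * x) ^+ n - (4 * x) ^+ m).
  move/le_trans; apply; rewrite mulrBr exprMn !mulrA lerBlDr lerDl.
  by rewrite !mulr_ge0 // exprn_ge0 //; lra.
elim: m le_nm => [|m IH].
  by rewrite leqn0 => /eqP ->; rewrite /series /= !subrr normr0 mulr0.
rewrite leq_eqVlt => /predU1P[->|/IH{}IH].
  by rewrite /series /= !subrr normr0 mulr0.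
rewrite seriesSr addrAC; apply: le_trans (ler_normD _ _) _.
have hm : `|s m * x ^+ m| <= B * (4 * x) ^+ m.
  rewrite normrM (gtr0_norm (exprn_gt0 m x0)) exprMn mulrA.
  by rewrite ler_pM2r ?exprn_gt0.
have y0 : 0 <= B * (4 * x) ^+ m by rewrite mulr_ge0 // exprn_ge0 //; lra.
rewrite exprS; move: IH hm y0; move: ((4 * x) ^+ m) => y IH hm y0; nra.
Qed.

End Approximation.

Lemma qpochs_inf2 (C : numClosedFieldType) (a b q : C) :
  qpochs_inf [:: a; b] q = qpoch_inf a q * qpoch_inf b q.
Proof. by rewrite /qpochs_inf big_cons big_seq1. Qed.

Section QPochhammerApprox.
Variables (R : realType) (c : R) (e d : nat).
Hypotheses (c1 : `|c| = 1) (e0 : (0 < e)%N) (d0 : (0 < d)%N).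

Definition qpoch_real (x : R) : R := limn (qpoch_part (c * x ^+ e) (x ^+ d)).

Lemma expr_le_base (x : R) k : 0 < x -> x <= 4^-1 -> (0 < k)%N -> `|x ^+ k| <= x.
Proof.
move=> x0 x4; case: k => // k _; rewrite normrX gtr0_norm // exprS.
rewrite ler_piMr ?exprn_ile1 ?ltW //; lra.
Qed.

Lemma qpoch_infE (x : R) : 0 < x -> x <= 4^-1 ->
  qpoch_inf (c%:C * x%:C ^+ e : Cplx R) (x%:C ^+ d) = (qpoch_real x)%:C.
Proof.
move=> x0 x4; rewrite -!rmorphXn -rmorphM; apply: (qpoch_inf_real x0 x4).
  by rewrite normrM c1 mul1r expr_le_base.
exact: expr_le_base.
Qed.

Lemma approx_qpoch n : approx n qpoch_real (qpoch_poly (- c) e d n).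
Proof.
exists 1 => x x0 x8; have x4 : x <= 4^-1 by lra.
have -> : (qpoch_poly (- c) e d n).[x] = qpoch_part (c * x ^+ e) (x ^+ d) n.
  rewrite /qpoch_part big_mkord horner_prod; apply: eq_bigr => k _.
  by rewrite !(hornerE, hornerXn) exprD exprM mulNr mulrA.
rewrite mul1r; apply: qpoch_part_lim_dist => //.
  by rewrite normrM c1 mul1r expr_le_base.
exact: expr_le_base.
Qed.

End QPochhammerApprox.

(** Both claims are instances. The expansion is used only at real points of [(0, 1/4]]. *)
Lemma qpoch_product_vanishing (R : realType) (al be al' be' : nat)
    (del : int) (r : nat) (s : nat -> int) :
    (0 < al)%N -> (0 < be)%N -> (0 < al')%N -> (0 < be')%N ->
    (al + be = 5)%N -> (al' + be' = 10)%N ->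
    al'%:Z - be'%:Z = 3 * (al%:Z - be%:Z) - 5 * del -> odd `|del|%N ->
    (forall z : int,
      (exists y : int, (al%:Z - be%:Z) * z - 2 * r%:Z = 5 * y) ->
      exists k : int, 2 * z + del = 5 * k) ->
    power_series_expansion s (fun q : Cplx R =>
      qpochs_inf [:: q ^+ be; q ^+ al] (q ^+ 5) ^+ 3
        * qpochs_inf [:: - q ^+ be'; - q ^+ al'] (q ^+ 10)) ->
  forall m, m = r %[mod 5] -> s m = 0.
Proof.
move=> al0 be0 al'0 be'0 sum5 sum10 slope del_odd residue hs m mr.
have n1 : `|1 : R| = 1 by rewrite normr1.
have nN1 : `|-1 : R| = 1 by rewrite normrN1.
pose g (x : R) := (qpoch_real 1 al 5 x * qpoch_real 1 be 5 x) ^+ 3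
  * (qpoch_real (-1) al' 10 x * qpoch_real (-1) be' 10 x).
have hg (x : R) : 0 < x -> x <= 4^-1 ->
    series (fun k => (s k)%:~R * x ^+ k) @ \oo --> g x.
  move=> x0 x4; apply/cvg_real_complex.
  have x_lt1 : `|x%:C : Cplx R| < 1.
    rewrite normc_def /= expr0n addr0 sqrtr_sqr ltcR gtr0_norm //.
    by apply: le_lt_trans x4 _; rewrite invf_lt1 ?ltr1n.
  have E1 k : (0 < k)%N ->
    qpoch_inf (x%:C ^+ k : Cplx R) (x%:C ^+ 5) = (qpoch_real 1 k 5 x)%:C.
    by move=> k0; rewrite -(qpoch_infE n1) // rmorph1 mul1r.
  have E2 k : (0 < k)%N ->
    qpoch_inf (- x%:C ^+ k : Cplx R) (x%:C ^+ 10) = (qpoch_real (-1) k 10 x)%:C.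
    by move=> k0; rewrite -(qpoch_infE nN1) // rmorphN1 mulN1r.
  have Ef : qpochs_inf [:: x%:C ^+ be; x%:C ^+ al] (x%:C ^+ 5) ^+ 3
      * qpochs_inf [:: - x%:C ^+ be'; - x%:C ^+ al'] (x%:C ^+ 10)
      = (g x)%:C :> Cplx R.
    rewrite !qpochs_inf2 !E1 // !E2 // -!rmorphM -rmorphXn -rmorphM.
    by congr (_ ^+ 3 * _)%:C; rewrite mulrC.
  have := hs _ x_lt1; rewrite Ef.
  suff -> : series (fun k => (s k)%:~R * (x%:C : Cplx R) ^+ k) =
      (fun n => (series (fun k => (s k)%:~R * x ^+ k) n)%:C) by [].
  apply/funext => n; rewrite /series /= rmorph_sum; apply: eq_bigr => k _.
  by rewrite rmorphM rmorphXn rmorph_int.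
(* Order [m.+1] is what determines the coefficient of index [m]. *)
have aS := approx_series m.+1 hg.
have aP : approx m.+1 g
    ((qpoch_poly (-1 : R) al 5 m.+1 * qpoch_poly (-1) be 5 m.+1) ^+ 3
   * (qpoch_poly 1 al' 10 m.+1 * qpoch_poly 1 be' 10 m.+1)).
  have a1 k : (0 < k)%N -> approx m.+1 (qpoch_real (1 : R) k 5) (qpoch_poly (-1) k 5 m.+1).
    by move=> k0; apply: approx_qpoch.
  have a2 k : (0 < k)%N -> approx m.+1 (qpoch_real (-1 : R) k 10) (qpoch_poly 1 k 10 m.+1).
    by move=> k0; have := approx_qpoch nN1 k0 (isT : (0 < 10)%N) m.+1; rewrite opprK.
  have a3 := approxM (a1 _ al0) (a1 _ be0).
  exact: approxM (approxM a3 (approxM a3 a3)) (approxM (a2 _ al'0) (a2 _ be'0)).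
have /dvdXnP/(_ m (ltnSn m)) := approx_unique aS aP.
rewrite coefB coef_poly ltnSn.
rewrite (coef_qpoch_prod R al0 be0 al'0 be'0 sum5 sum10 slope del_odd residue) //.
by rewrite subr0 => /eqP; rewrite intr_eq0 => /eqP.
Qed.

Theorem theorem13 (R : realType) (s t : nat -> int)
  (hs : power_series_expansion s (fun q : Cplx R =>
     qpochs_inf [:: q; q ^+ 4] (q ^+ 5) ^+ 3
       * qpochs_inf [:: - q ^+ 3; - q ^+ 7] (q ^+ 10)))
  (ht : power_series_expansion t (fun q : Cplx R =>
     qpochs_inf [:: q ^+ 2; q ^+ 3] (q ^+ 5) ^+ 3
       * qpochs_inf [:: - q; - q ^+ 9] (q ^+ 10))) :
  (forall n : nat, s (5 * n + 3)%N = 0) /\ (forall n : nat, t (5 * n + 4)%N = 0).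
Proof.
split=> n.
  have hs1 : power_series_expansion s (fun q : Cplx R =>
      qpochs_inf [:: q ^+ 1; q ^+ 4] (q ^+ 5) ^+ 3
        * qpochs_inf [:: - q ^+ 3; - q ^+ 7] (q ^+ 10)).
    by move=> q q_lt1; rewrite expr1; apply: hs.
  apply: (@qpoch_product_vanishing R 4 1 7 3 1 3 s _ _ _ _ _ _ _ _ _ hs1);
    [by [] | by [] | by [] | by [] | by [] | by [] | by [] | by [] | |].
    (* Here [3 z - 6 = 5 y], hence [2 z + 1 = 5 z - 5 y - 5]. *)
    by move=> z [y hy]; exists (z - y - 1); lia.
  by rewrite mulnC modnMDl.
have ht1 : power_series_expansion t (fun q : Cplx R =>
    qpochs_inf [:: q ^+ 2; q ^+ 3] (q ^+ 5) ^+ 3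
      * qpochs_inf [:: - q ^+ 1; - q ^+ 9] (q ^+ 10)).
  by move=> q q_lt1; rewrite expr1; apply: ht.
apply: (@qpoch_product_vanishing R 3 2 9 1 (-1) 4 t _ _ _ _ _ _ _ _ _ ht1);
  [by [] | by [] | by [] | by [] | by [] | by [] | by [] | by [] | |].
  (* Here [z - 8 = 5 y], hence [2 z - 1 = 10 y + 15]. *)
  by move=> z [y hy]; exists (2 * y + 3); lia.
by rewrite mulnC modnMDl.
Qed.
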